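(* Let $N$ be a positive integer, $A\subseteq[1,N]$, and let $m\geq3$ be an odd positive integer. If \[\frac{|A|}{N}\geq 4N^{-2/(m-1)},\] then the difference set $A-A$ contains an arithmetic progression (with nonzero common difference) of length at least $m$.
   Context: $[1,N]=\{1,2,\dots,N\}$; $A-A=\{a-a':a,a'\in A\}$. *)

(* Defs.v *)
From HB Require Import structures.
From mathcomp Require Import all_boot all_order all_algebra finmap.
From mathcomp Require Import all_classical all_reals all_analysis.
Set Implicit Arguments.
Unset Strict Implicit.
Unset Printing Implicit Defensive.
Import Order.TTheory GRing.Theory Num.Theory.
Local Open Scope fset_scope.
Local Open Scope ring_scope.

Definition diffset (A : {fset int}) : {fset int} :=
  [fset a - a' | a in A, a' in A].

Definition contains_AP (S : {fset int}) (k : nat) : Prop :=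
  exists a d : int, d != 0 /\ forall i : nat, (i < k)%N -> a + d *+ i \in S.

(* Main.v *)
Require Import Defs.
From HB Require Import structures.
From mathcomp Require Import all_boot all_order all_algebra finmap.
From mathcomp Require Import all_classical all_reals all_analysis.
From mathcomp Require Import zify ring.
Set Implicit Arguments.
Unset Strict Implicit.
Unset Printing Implicit Defensive.
Import Order.TTheory GRing.Theory Num.Theory.
Local Open Scope fset_scope.
Local Open Scope ring_scope.

(** Write [m = 2 l + 1] and [T = N %/ l + 1].  The map
    [(a_1, ..., a_l, t) |-> (a_j + j t)_j] sends [A ^ l * [0, T)] into the box
    [[1, 2 N] ^ l], and the density hypothesis makes the domain larger than the
    box.  A collision [a_j + j t = a'_j + j t'] for all [j] gives
    [j (t' - t) = a_j - a'_j], so [A - A] contains all multiples [j d],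
    [|j| <= l], of [d = t' - t], which is nonzero. *)

Lemma diffsetP (A : {fset int}) (x : int) :
  reflect (exists a b, [/\ a \in A, b \in A & x = a - b]) (x \in diffset A).
Proof.
rewrite /diffset; apply: (iffP (imfset2P _ _ _ _ _)) => /=.
  by case=> a aA [b bA ->]; exists a, b.
by case=> a [b [aA bA ->]]; exists a => //; exists b.
Qed.

Lemma diffsetN (A : {fset int}) (x : int) :
  x \in diffset A -> - x \in diffset A.
Proof.
move=> /diffsetP[a [b [aA bA ->]]]; apply/diffsetP.
by exists b, a; split=> //; rewrite opprB.
Qed.

Lemma diffset0 (A : {fset int}) : (0 < #|` A|)%N -> 0 \in diffset A.
Proof.
rewrite cardfs_gt0 => /fset0Pn[a aA]; apply/diffsetP.
by exists a, a; split=> //; rewrite subrr.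
Qed.

(** The progression is centred at 0, running from [- l d] to [l d]; the symmetry of [A - A] supplies
    its negative half. *)
Lemma contains_AP_diffset (A : {fset int}) (l : nat) (d : int) :
  d != 0 -> (forall i : nat, (i <= l)%N -> d *+ i \in diffset A) ->
  contains_AP (diffset A) l.*2.+1.
Proof.
move=> d0 dA; exists (- (d *+ l)), d; split=> // i ilt.
have [li|il] := leqP l i.
  by rewrite addrC -mulrnBr //; apply: dA; lia.
rewrite -(opprK (d *+ i)) -opprD -mulrnBr; last exact: ltnW.
by apply/diffsetN/dA; lia.
Qed.

Lemma diffset_multiples (A : {fset int}) (N l : nat) :
  (0 < N)%N -> (forall a : int, a \in A -> 1 <= a <= N%:Z) ->
  ((2 * N) ^ l < #|` A| ^ l * (N %/ l).+1)%N ->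
  exists2 d : int, d != 0 &
    forall i : nat, (0 < i <= l)%N -> d *+ i \in diffset A.
Proof.
move=> N0 hA hcard.
(* Ordinals start at 0, so the multiplier of [t] is [j.+1], and the predecessor moves [[1, 2 N]] to
   [[0, 2 N)]. *)
pose v (p : {ffun 'I_l -> A} * 'I_(N %/ l).+1) (j : 'I_l) : nat :=
  (`|fsval (p.1 j)|%N + j.+1 * p.2).-1.
pose f p : {ffun 'I_l -> 'I_(2 * N).-1.+1} := [ffun j => inord (v p j)].
have absA (x : A) : (`|fsval x|%N)%:Z = fsval x /\ (0 < `|fsval x| <= N)%N.
  by have := hA _ (fsvalP x); lia.
have v_lt p j : (v p j < (2 * N).-1.+1)%N.
  have [_ xN] := absA (p.1 j).
  (* The range of [t] is chosen for this bound: [j.+1 <= l] and [t <= N %/ l]. *)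
  have tN : (j.+1 * p.2 <= N)%N.
    apply: leq_trans (leq_trunc_div N l); rewrite mulnC.
    by apply: leq_mul; rewrite // -ltnS.
  rewrite /v; lia.
have /injectivePn[p [q pq fpq]] : ~~ injectiveb f.
  apply/negP => /injectiveP/leq_card.
  rewrite card_prod !card_ffun !card_ord -cardfE leqNgt prednK ?hcard //.
  by rewrite muln_gt0.
have key j : fsval (p.1 j) - fsval (q.1 j) = (q.2%:Z - p.2%:Z) *+ j.+1.
  have /(congr1 val) := congr1 (fun g : {ffun _ -> _} => g j) fpq.
  rewrite !ffunE /= !inordK // /v.
  rewrite -mulr_natr natz.
  (* Elements of [A] are positive, so the truncated predecessor in [v] loses no information. *)
  move: (absA (p.1 j)) (absA (q.1 j)).
  move: `|fsval (p.1 j)|%N `|fsval (q.1 j)|%N => x y [<- x0] [<- y0]; lia.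
exists (q.2%:Z - p.2%:Z).
  (* If [t = t'], then [key] forces [a_j = a'_j] for every [j], and the colliding points
     coincide. *)
  apply: contra_neq pq => d0.
  have t_eq : p.2 = q.2 by move/eqP: d0; rewrite subr_eq0 => /eqP[/val_inj].
  move: key t_eq; case: (p) (q) => [a t] [b u] /= key t_eq.
  rewrite t_eq in key *; congr pair; apply/ffunP => j; apply: val_inj.
  by apply/eqP; rewrite -subr_eq0 key subrr mul0rn.
move=> [//|i] /= il; apply/diffsetP.
exists (fsval (p.1 (Ordinal il))), (fsval (q.1 (Ordinal il))).
by split; rewrite ?fsvalP // key.
Qed.

(** With [m = 2 l + 1] the exponent is [-1 / l], so the [l]-th power of the density bound has right
    side [4 ^ l / N], free of real powers. *)
Lemma card_of_density (R : realType) (N l c : nat) : (0 < N)%N -> (0 < l)%N ->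
  (c%:R / N%:R >= 4 * (N%:R : R) `^ (- 2 / (l.*2.+1%:R - 1))) ->
  (4 ^ l * N ^ l <= c ^ l * N)%N.
Proof.
move=> N0 l0 h.
have NR : (N%:R : R) != 0 by rewrite pnatr_eq0 -lt0n.
have lR : (l%:R : R) != 0 by rewrite pnatr_eq0 -lt0n.
have -> : (4 ^ l * N ^ l <= c ^ l * N)%N
    = ((4 ^+ l * N%:R ^+ l : R) <= c%:R ^+ l * N%:R).
  by rewrite -(ler_nat R) !natrM !natrX.
have e : (- 2 / (l.*2.+1%:R - 1)) * l%:R = -1 :> R.
  rewrite -[l.*2.+1%:R]natr1 addrK -muln2 natrM; by field.
have : (4 * (N%:R : R) `^ (- 2 / (l.*2.+1%:R - 1))) ^+ l <= (c%:R / N%:R) ^+ l.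
  by rewrite lerXn2r ?nnegrE ?mulr_ge0 ?powR_ge0 ?invr_ge0 ?ler0n.
rewrite exprMn -[X in _ * X]powR_mulrn ?powR_ge0 // -powRrM e.
rewrite powR_inv1 ?ler0n // expr_div_n ler_pdivlMr ?exprn_gt0 ?ltr0n //.
by rewrite mulrAC ler_pdivrMr ?ltr0n.
Qed.

Lemma box_lt_domain (N l c : nat) : (0 < N)%N -> (0 < l)%N ->
  (4 ^ l * N ^ l <= c ^ l * N)%N -> ((2 * N) ^ l < c ^ l * (N %/ l).+1)%N.
Proof.
move=> N0 l0 h; rewrite -(ltn_pmul2r N0).
apply: (@leq_trans (4 ^ l * N ^ l * (N %/ l).+1)); last first.
  by rewrite [leqRHS]mulnAC leq_mul2r h orbT.
have -> : (4 ^ l * N ^ l * (N %/ l).+1 = (2 * N) ^ l * (2 ^ l * (N %/ l).+1))%N.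
  by rewrite -[4%N]/(2 * 2)%N !expnMn; ring.
rewrite ltn_pmul2l ?expn_gt0 ?muln_gt0 ?N0 //.
(* What remains is [N < 2 ^ l * (N %/ l).+1], from [N < l * (N %/ l).+1] and [l < 2 ^ l]. *)
apply: leq_trans (ltn_ceil N l0) _; rewrite mulnC leq_mul2r ltnW ?orbT //.
exact: ltn_expl.
Qed.

Theorem theorem2p1 (R : realType) (N m : nat) (A : {fset int})
    (hN : (0 < N)%N)
    (hA : forall a : int, a \in A -> 1 <= a <= N%:Z)
    (hm : (3 <= m)%N) (hodd : odd m)
    (hdens : (#|` A|)%:R / N%:R >= 4 * (N%:R : R) `^ (- 2 / (m%:R - 1))) :
  exists k : nat, (m <= k)%N /\ contains_AP (diffset A) k.
Proof.
pose l := m./2.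
have ml : m = l.*2.+1 by rewrite -[LHS]odd_double_half hodd.
have l0 : (0 < l)%N by lia.
rewrite ml in hdens.
have hlt := box_lt_domain hN l0 (card_of_density hN l0 hdens).
exists m; split=> //; rewrite ml.
have [d d0 dA] := diffset_multiples hN hA hlt.
apply: (contains_AP_diffset d0) => -[_|i il]; last exact: dA.
(* The middle term 0 needs [A] nonempty: since [0 < l], an empty [A] would make the right side of
   [hlt] zero. *)
apply: diffset0; rewrite lt0n; apply/eqP => A0.
by rewrite A0 exp0n in hlt.
Qed.
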